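(* Let $0<\gamma\leq\alpha<1$, $q>1$, $\tau\geq 1$, and let $w$ be a weight on $\mathbb{R}^{n+1}$. For a parabolic rectangle $R=R(x,t,L)$ let $S^-(\alpha)=R^+(\alpha)-(0,\tau(1+\alpha)L^p)$ denote the translate of $R^+(\alpha)$ by $\tau(1+\alpha)L^p$ backward in time (the translated lower part of $R$). Then $w\in A^+_q(\gamma)$ if and only if there exists a constant $C$ (which, when $w\in A_q^+(\gamma)$, can be chosen to depend only on $n,p,q,\gamma,\alpha,\tau$ and $[w]_{A_q^+(\gamma)}$) such that \[ \biggl(\frac{1}{|S^-(\alpha)|}\int_{S^-(\alpha)} w\biggr)\biggl(\frac{1}{|R^+(\alpha)|}\int_{R^+(\alpha)} w^{\frac{1}{1-q}}\biggr)^{q-1}\leq C \] for every parabolic rectangle $R=R(x,t,L)\subset\mathbb{R}^{n+1}$. Moreover, $w\in A_1^+(\gamma)$ if and only if there exists a constant $C$ such that \[ \frac{1}{|S^-(\alpha)|}\int_{S^-(\alpha)} w\leq C\operatorname*{ess\,inf}_{(x,t)\in R^+(\alpha)} w(x,t) \] for every parabolic rectangle $R\subset\mathbb{R}^{n+1}$.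
   Context: Fix a dimension $n\ge1$ and an exponent $1<p<\infty$. For $x\in\mathbb{R}^n$, $L>0$ let $Q(x,L)=\{y\in\mathbb{R}^n:|y_i-x_i|\le L,\ i=1,\dots,n\}$. For $t\in\mathbb{R}$, the parabolic rectangle centered at $(x,t)$ with side length $L$ is $R=R(x,t,L)=Q(x,L)\times(t-L^p,t+L^p)\subset\mathbb{R}^{n+1}$. For $0\le\gamma<1$ (the time lag) its upper and lower parts are $R^+(\gamma)=Q(x,L)\times(t+\gamma L^p,t+L^p)$ and $R^-(\gamma)=Q(x,L)\times(t-L^p,t-\gamma L^p)$. $|A|$ is the Lebesgue measure of $A\subset\mathbb{R}^{n+1}$; integrals are with respect to Lebesgue measure. A weight is a locally integrable nonnegative function on $\mathbb{R}^{n+1}$. For $1<q<\infty$, $w\in A_q^+(\gamma)$ means \[ [w]_{A_q^+(\gamma)}=\sup_{R}\biggl(\frac{1}{|R^-(\gamma)|}\int_{R^-(\gamma)}w\biggr)\biggl(\frac{1}{|R^+(\gamma)|}\int_{R^+(\gamma)}w^{\frac1{1-q}}\biggr)^{q-1}<\infty, \] the supremum over all parabolic rectangles $R\subset\mathbb{R}^{n+1}$. $w\in A_1^+(\gamma)$ means there is a constant $C=[w]_{A_1^+(\gamma)}>0$ with $\frac{1}{|R^-(\gamma)|}\int_{R^-(\gamma)}w\le C\operatorname{ess\,inf}_{R^+(\gamma)}w$ for every parabolic rectangle $R$. *)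

(* Defs.v *)
From HB Require Import structures.
From mathcomp Require Import all_boot all_order all_algebra.
From mathcomp Require Import all_classical all_reals all_analysis.
From mathcomp Require Import measurable_realfun ess_sup_inf.

Set Implicit Arguments.
Unset Strict Implicit.
Unset Printing Implicit Defensive.

Import Order.TTheory GRing.Theory Num.Theory.
Import numFieldNormedType.Exports.

Local Open Scope classical_set_scope.
Local Open Scope ring_scope.

(* R^n as the tuples over R, with the product (= Borel) sigma-algebra. *)
Notation Rn R n := (n.-tuple (measurableTypeR R)).
(* R^{n+1} = R^n x R, the last coordinate being time. *)
Notation spacetime R n := (Rn R n * measurableTypeR R)%type.

Section lebesgue_Rn.
Context {R : realType}.
Local Open Scope ereal_scope.

Section step.
Context {n : nat} (m : {sigma_finite_measure set (Rn R n) -> \bar R}).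

Definition consRn (z : measurableTypeR R * Rn R n) : Rn R n.+1 :=
  [tuple of z.1 :: z.2].

Lemma measurable_consRn : measurable_fun [set: measurableTypeR R * Rn R n] consRn.
Proof. exact: measurable_cons. Qed.

Definition lebesgue_step : set (Rn R n.+1) -> \bar R :=
  pushforward (@lebesgue_measure R \x m) consRn.

Let lebesgue_step0 : lebesgue_step set0 = 0.
Proof. by rewrite /lebesgue_step /pushforward preimage_set0 measure0. Qed.

Let lebesgue_step_ge0 A : 0 <= lebesgue_step A.
Proof. by rewrite /lebesgue_step /pushforward measure_ge0. Qed.

Let mstep (A : set (Rn R n.+1)) : measurable A -> measurable (consRn @^-1` A).
Proof. by move=> mA; rewrite -[X in measurable X]setTI; exact: measurable_consRn. Qed.

Let lebesgue_step_sigma_additive : semi_sigma_additive lebesgue_step.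
Proof.
move=> F mF tF mUF; rewrite /lebesgue_step /pushforward preimage_bigcup.
apply: measure_semi_sigma_additive.
- by move=> i; exact: mstep.
- apply/trivIsetP => /= i j _ _ ij; rewrite -preimage_setI.
  by move/trivIsetP : tF => /(_ _ _ _ _ ij) ->//; rewrite preimage_set0.
- by rewrite -preimage_bigcup; exact: mstep.
Qed.

HB.instance Definition _ := isMeasure.Build _ _ _ lebesgue_step
  lebesgue_step0 lebesgue_step_ge0 lebesgue_step_sigma_additive.

Let lebesgue_step_sigma_finite : sigma_finite setT lebesgue_step.
Proof.
have /sigma_finiteP[F [FT ndF Foo]] := sigma_finiteT (@lebesgue_measure R).
have /sigma_finiteP[G [GT ndG Goo]] := sigma_finiteT m.
pose tl (y : Rn R n.+1) : Rn R n := [tuple of behead y].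
have mhd : measurable_fun [set: Rn R n.+1] (@thead n (measurableTypeR R)).
  exact: (@measurable_tnth _ _ n.+1 ord0).
have mtl : measurable_fun [set: Rn R n.+1] tl.
  exact: measurable_behead.
exists (fun k => [set y | F k (thead y) /\ G k (tl y)]).
  apply/esym; rewrite -subTset => y _.
  have [i _ Fi] : (\bigcup_i F i) (thead y) by rewrite -FT.
  have [j _ Gj] : (\bigcup_i G i) (tl y) by rewrite -GT.
  exists (maxn i j) => //; split.
    by move: (thead y) Fi; exact/subsetPset/ndF/leq_maxl.
  by move: (tl y) Gj; exact/subsetPset/ndG/leq_maxr.
move=> k; have [mF Fk] := Foo k; have [mG Gk] := Goo k; split.
  rewrite [X in measurable X](_ : _ = (@thead n _) @^-1` F k `&`
      tl @^-1` G k)//.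
  by apply: measurableI; rewrite -[X in measurable X]setTI;
    [exact: mhd|exact: mtl].
rewrite /lebesgue_step /pushforward.
rewrite [X in product_measure1 _ _ X](_ : _ = F k `*` G k).
  by rewrite product_measure1E// lte_mul_pinfty// ge0_fin_numE.
apply/seteqP; split=> -[a t] /=.
  by rewrite theadE (_ : tl _ = t)//; exact/val_inj.
by rewrite theadE (_ : tl _ = t)//; exact/val_inj.
Qed.

HB.instance Definition _ := Measure_isSigmaFinite.Build _ _ _ lebesgue_step
  lebesgue_step_sigma_finite.

End step.

(* n-dimensional Lebesgue measure: the n-fold product of lebesgue_measure. *)
Fixpoint lebesgue_Rn n : {sigma_finite_measure set (Rn R n) -> \bar R} :=
  if n is n'.+1 then lebesgue_step (lebesgue_Rn n')
  else \d_([tuple] : Rn R 0).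

End lebesgue_Rn.

Section parabolic.
Context {R : realType} {n : nat}.
Implicit Types (p q L t a b : R) (x : Rn R n) (w : spacetime R n -> R).
Local Open Scope ereal_scope.

Definition lebesgue_st : {measure set (spacetime R n) -> \bar R} :=
  lebesgue_Rn n \x @lebesgue_measure R.
Local Notation mu := lebesgue_st.

Definition cube x L : set (Rn R n) :=
  [set y | forall i, (`|tnth y i - tnth x i| <= L)%R].

(* R^+(a) and R^-(a) for R = R(x,t,L). *)
Definition upper p a x t L : set (spacetime R n) :=
  cube x L `*` `](t + a * L `^ p)%R, (t + L `^ p)%R[%classic.

Definition lower p a x t L : set (spacetime R n) :=
  cube x L `*` `](t - L `^ p)%R, (t - a * L `^ p)%R[%classic.

Definition translated_lower p a tau x t L : set (spacetime R n) :=
  [set (z.1, z.2 - tau * (1 + a) * L `^ p)%R | z in upper p a x t L].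

(* Measurability with respect to the completion of the Borel measure mu, i.e.
   Lebesgue measurability. *)
Definition lebesgue_measurable_fun w :=
  forall Y : set R, measurable Y -> completed_algebra_gen mu (w @^-1` Y).

(* [n.-tuple R] has no topology in the library: compact subsets of R^{n+1} are
   taken in ['rV_n * R]. For a nonnegative f, [\int] is a supremum over Borel
   simple functions below f; if f is only Lebesgue measurable, this supremum is
   still its Lebesgue integral. *)
Definition locally_integrable_st w := lebesgue_measurable_fun w /\
  forall K : set ('rV[R]_n * R)%type, compact K ->
    \int[mu]_(z in [set z | K (\row_i tnth z.1 i, z.2)]) `|w z|%:E < +oo.

Definition weight w := (forall z, 0 <= w z)%R /\ locally_integrable_st w.

Definition avg (A : set (spacetime R n)) (f : spacetime R n -> \bar R) : \bar R :=
  (mu A)^-1 * \int[mu]_(z in A) f z.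

(* w^(1/(1-q)) with the value +oo where w = 0, as the exponent is negative
   ([powR] would give 0). *)
Definition dual_weight q w (z : spacetime R n) : \bar R :=
  if w z == 0%R then +oo else (w z `^ (1 / (1 - q)))%:E.

(* In the products below, 0 * +oo = 0. *)
Definition Aq_product q (A B : set (spacetime R n)) w : \bar R :=
  avg A (EFin \o w) * poweR (avg B (dual_weight q w)) (q - 1).

Definition Aq_const p q a w : \bar R :=
  ereal_sup [set r | exists x t L,
    (0 < L)%R /\ r = Aq_product q (lower p a x t L) (upper p a x t L) w].

Definition in_Aq p q a w := Aq_const p q a w < +oo.

(* Essential infimum over A: the value +oo off A is irrelevant. *)
Definition ess_inf_on (A : set (spacetime R n)) w : \bar R :=
  ess_inf mu (patch (cst +oo) A (EFin \o w)).

Definition in_A1 p a w := exists2 C : R, (0 < C)%R &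
  forall x t L, (0 < L)%R ->
    avg (lower p a x t L) (EFin \o w) <= C%:E * ess_inf_on (upper p a x t L) w.

End parabolic.

(* Main.v *)
Require Import Defs.
From mathcomp Require Import all_boot all_order all_algebra.
From mathcomp Require Import all_classical all_reals all_analysis.
From mathcomp Require Import measurable_realfun ess_sup_inf.
From mathcomp Require Import ring lra zify.

(** Both conditions of the theorem have the form
      [avg A w <= C * m B]
    for a pair of sets with [A] earlier in time than [B], where [m B] is the
    essential infimum of [w] over [B] for A_1, and the negative power mean
    [(avg B w^(1/(1-q)))^(1-q)] for A_q. Only two properties of [m] enter the
    argument: [m B <= avg B w] (for A_q this is Jensen's inequality), and a bound
    [X <= m B_j] over the sets of a finite cover of [B] passes to [m B], up to a
    factor depending on the number and the relative size of the [B_j]. A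
    functional with these properties is called a [lower_mean], and the theorem is
    proved once for all nonnegative ones.

    From the lag [gamma] to the translated rectangles
    ([one_sided_translated]): after enlarging its side length and moving its
    centre back in time, one rectangle [R'] has [R'^-(gamma)] containing
    [S^-(alpha)] and [R'^+(gamma)] containing [R^+(alpha)]. This works because the
    time gap between [S^-(alpha)] and [R^+(alpha)] is at least [2 alpha L^p], and
    because the size of [R'] is comparable to that of [R].

    From the translated rectangles to the lag [gamma] ([one_sided_lag]): the gap
    between [R^-(gamma)] and [R^+(gamma)] may be much smaller than the
    one in the assumption, so the assumption is used at a small scale
    [l = 2 L / N]. It compares the average of [w] on a box [P] with [m] on any box
    [P'] that lies later by about [tau (1 + alpha) l^p] in time and is displaced by
    at most [l / 2] in space ([one_sided_box_step]). Since [m P' <= avg P' w], such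
    comparisons can be chained ([one_sided_box_chain]). Crossing a distance [2 L] in
    space takes about [4 L / l] steps, hence a time of order [L l^(p-1)], which tends
    to [0] with [l] because [p > 1]. So for [N] large any box in [R^-(gamma)] can be
    joined to any box in [R^+(gamma)]: the number of steps is chosen to match the
    time difference, and the displacement is spread evenly over the steps
    ([one_sided_far_boxes]). Covering both sets by grids of boxes finishes the
    proof.

    A weight is only Lebesgue measurable, so [\int], a supremum over Borel simple
    functions, is handled as a lower integral: it is monotone and finitely
    subadditive over Borel sets for every nonnegative function. Measurability is used only in Jensen's inequality, after removal of a
    Borel null set off which the weight is Borel ([lebesgue_measurable_borel]). *)

Set Implicit Arguments.
Unset Strict Implicit.
Unset Printing Implicit Defensive.

Import Order.TTheory GRing.Theory Num.Theory.
Local Open Scope classical_set_scope.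
Local Open Scope ring_scope.

(** * Meshes and choice of the scale *)

Section real_lemmas.
Context {R : realType}.
Implicit Types a b u p c A d e g N : R.

(** The midpoints of the [M] subintervals of equal length of [[a, b]]. *)
Definition mesh (M : nat) a b (j : nat) : R :=
  a + (j.*2.+1)%:R * ((b - a) / (2 * M%:R)).

Lemma mesh_itv (M : nat) a b (j : 'I_M) : a <= b -> a <= mesh M a b j <= b.
Proof.
move=> ab; have M0 : (0 < M%:R :> R) by rewrite ltr0n (leq_ltn_trans (leq0n j)).
have d0 : 0 <= (b - a) / (2 * M%:R) by rewrite divr_ge0 ?subr_ge0// mulr_ge0// ltW.
have bE : b = a + 2 * M%:R * ((b - a) / (2 * M%:R)) by field; rewrite gt_eqF.
rewrite /mesh lerDl mulr_ge0//= [leRHS]bE lerD2l ler_wpM2r//.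
by rewrite -natrM ler_nat mul2n; have := ltn_ord j; lia.
Qed.

Lemma mesh_cover (M : nat) a b u : (0 < M)%N -> a < b -> a <= u <= b ->
  exists j : 'I_M, `|u - mesh M a b j| <= (b - a) / (2 * M%:R).
Proof.
move=> M0 ab /andP[au ub].
have MR : 0 < M%:R :> R by rewrite ltr0n.
rewrite /mesh; set d := (b - a) / _.
have d0 : 0 < d by rewrite divr_gt0 ?subr_gt0// mulr_gt0.
have bE : b = a + M%:R * (2 * d) by rewrite /d; field; rewrite gt_eqF.
have v0 : 0 <= (u - a) / (2 * d) by rewrite divr_ge0 ?subr_ge0// ltW// mulr_gt0.
have jE (j : nat) : j.*2.+1%:R = 2 * j%:R + 1 :> R by rewrite -natr1 -mul2n natrM.
have /andP[] := truncn_itv v0; set j := Num.trunc _.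
have dd : 0 < 2 * d by rewrite mulr_gt0.
rewrite (ler_pdivlMr _ _ dd) (ltr_pdivrMr _ _ dd) => j1; rewrite -natr1 => j2.
have [jM|Mj] := ltnP j M.
  by exists (Ordinal jM); rewrite /= jE ler_distl; apply/andP; split; lra.
(* The truncation equals M exactly when u = b, which lies in the last cell. *)
have M1 : (M.-1 < M)%N by rewrite prednK.
exists (Ordinal M1); rewrite /= jE.
have -> : M.-1%:R = M%:R - 1 :> R by rewrite -{2}(prednK M0) -natr1 addrK.
have : M%:R * (2 * d) <= j%:R * (2 * d) by rewrite ler_wpM2r ?ler_nat// ltW// mulr_gt0.
by rewrite ler_distl => ?; apply/andP; split; lra.
Qed.

Lemma powR_dominates p c A : 1 < p -> 0 < c -> 0 <= A ->
  exists2 N : nat, (0 < N)%N & 2 * N%:R + A + 1 <= c * N%:R `^ p.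
Proof.
move=> p1 c0 A0; pose B := ((3 + A) / c) `^ (p - 1)^-1.
have B0 : 0 <= B by exact: powR_ge0.
exists (Num.trunc B).+1 => //; set N := (Num.trunc B).+1.
have NB : B <= N%:R by rewrite ltW// truncnS_gt.
have N1 : 1 <= N%:R :> R by rewrite ler1n.
have q0 : 0 < p - 1 by rewrite subr_gt0.
have : B `^ (p - 1) <= N%:R `^ (p - 1) by rewrite ge0_ler_powR ?nnegrE ?(ltW q0)//; lra.
have cA : 0 <= (3 + A) / c by rewrite divr_ge0 ?ltW//; lra.
rewrite /B -powRrM mulVf ?gt_eqF// powRr1// ler_pdivrMr// => AN.
have -> : N%:R `^ p = N%:R * N%:R `^ (p - 1).
  by rewrite -[in LHS](subrK 1 p) addrC [in LHS]powRD ?pnatr_eq0 ?implybT// powRr1.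
have : (3 + A) * N%:R <= (N%:R `^ (p - 1) * c) * N%:R by rewrite ler_wpM2r//; lra.
have : A <= A * N%:R by rewrite ler_peMr.
nra.
Qed.

(** This is where [1 < p] enters. With [l = 2 L / N], the time [L^p] contains of
    order [N^p] steps of duration [l^p], more than any multiple of the number [2 N]
    of steps that are needed in space. *)
Lemma small_scale p (a b g : R) : 1 < p -> 0 < a -> 0 < b -> 0 < g ->
  exists2 N : nat, (0 < N)%N &
    2 * N%:R + a / b + 1 <= 2 * g / (a * (2 `^ p / N%:R `^ p)).
Proof.
move=> p1 a0 b0 g0.
have p20 : (0 < 2 `^ p :> R) by rewrite powR_gt0.
have c0 : 0 < 2 * g / (2 `^ p * a) by rewrite divr_gt0// mulr_gt0.
have [N N0 NA] := powR_dominates p1 c0 (divr_ge0 (ltW a0) (ltW b0)).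
have Np : (0 < N%:R `^ p :> R) by rewrite powR_gt0// ltr0n.
exists N => //; apply: (le_trans NA); rewrite le_eqVlt; apply/orP; left; apply/eqP.
by field; rewrite !gt_eqF.
Qed.

(** The integer part of [dt / d] is off by less than one step [d], and [k + 1]
    steps absorb this error when each may deviate by [e] and [d / e <= k + 1]. *)
Lemma step_count N d e g (dt : R) : 0 < d -> 0 < e -> 0 <= N ->
  2 * N + d / e + 1 <= 2 * g / d -> 2 * g <= dt -> dt <= 2 ->
  exists k : nat, [/\ (k.+1 <= Num.trunc (2 / d))%N, 2 * N <= k.+1%:R
    & `|dt - k.+1%:R * d| <= k.+1%:R * e].
Proof.
move=> d0 e0 N0 Ng dt1 dt2.
have de0 : 0 < d / e by rewrite divr_gt0.
have gd : 2 * g / d <= dt / d by rewrite ler_wpM2r// invr_ge0 ltW.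
have dtd0 : 0 <= dt / d by lra.
have kmax : (Num.trunc (dt / d) <= Num.trunc (2 / d))%N.
  by apply: le_truncn; rewrite ler_wpM2r// invr_ge0 ltW.
have /andP[k1 k2] := truncn_itv dtd0; rewrite -natr1 in k2.
case: (Num.trunc (dt / d)) k1 k2 kmax => [|k] k1 k2 kmax; first by exfalso; lra.
exists k; split => //; first by lra.
have kde : d <= k.+1%:R * e by rewrite -ler_pdivrMr//; lra.
move: k1 k2; rewrite (ler_pdivlMr _ _ d0) (ltr_pdivrMr _ _ d0) => k1 k2.
by rewrite ler_distl; apply/andP; split; lra.
Qed.

End real_lemmas.

(** * Integrals of nonnegative functions without measurability *)

Section lower_integral.
Context {R : realType} d (T : measurableType d) (mu : {measure set T -> \bar R}).
Import HBNNSimple.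
Local Open Scope ereal_scope.
Implicit Types (A B : set T) (f g : T -> \bar R).

Lemma ge0_le_integral_sub A B f g : A `<=` B -> (forall x, 0 <= f x) ->
  (forall x, 0 <= g x) -> (forall x, A x -> f x <= g x) ->
  \int[mu]_(x in A) f x <= \int[mu]_(x in B) g x.
Proof.
move=> AB f0 g0 fg; rewrite !ge0_integralE//.
apply: le_ereal_sup => _ [h /= hf <-]; exists h => // x.
apply: (le_trans (hf x)); rewrite /patch.
case: ifPn => [/set_mem Ax|_]; last by case: ifP.
by rewrite ifT ?fg//; exact/mem_set/AB.
Qed.

(** Every simple function below [f] on [B] is at most the sum of its restrictions
    to the sets of the cover, and those are measurable whatever [f] is. *)
Lemma ge0_integral_cover (J : finType) B (B_ : J -> set T) f :
  (forall j, measurable (B_ j)) -> (forall x, 0 <= f x) ->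
  (forall x, B x -> exists j, B_ j x) ->
  \int[mu]_(x in B) f x <= \sum_(j : J) \int[mu]_(x in B_ j) f x.
Proof.
move=> mB f0 BB; rewrite [leLHS]ge0_integralE//.
apply: ge_ereal_sup => _ [h /= hf <-].
pose g j : T -> \bar R := (EFin \o h) \_ (B_ j).
have mg j : measurable_fun setT (g j).
  by apply/(measurable_restrictT _ (mB j)); apply/measurable_EFinP/measurable_funTS.
have g0 j x : 0 <= g j x by rewrite /g/patch; case: ifP => // _; rewrite lee_fin.
rewrite -integralT_nnsfun.
apply: (@le_trans _ _ (\int[mu]_x \sum_(j : J) g j x)).
  apply: ge0_le_integral => //.
  - by move=> x _; rewrite lee_fin.
  - exact/measurable_EFinP.
  - by apply: emeasurable_sum => j; exact: mg.
  - move=> x _; have [Bx|Bx] := pselect (B x).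
      have [j Bj] := BB _ Bx; rewrite (bigD1 j)//= [X in X + _]/g/patch mem_set//=.
      by rewrite leeDl// sume_ge0.
    by apply: (le_trans (hf x)); rewrite /patch memNset// sume_ge0.
rewrite ge0_integral_sum//.
apply: lee_sum => j _; rewrite -integral_mkcond.
apply: ge0_le_integral_sub => //= [x|x Bx]; first by rewrite lee_fin.
by apply: (le_trans (hf x)); rewrite /patch; case: ifP.
Qed.

End lower_integral.

(** * Lebesgue measure of space-time cylinders *)

Section lebesgue_cube.
Context {R : realType}.
Local Open Scope ereal_scope.

Lemma measurable_cube n (x : Rn R n) (L : R) : measurable (cube x L).
Proof.
rewrite (_ : cube x L = \bigcap_(i in [set: 'I_n])
    ((fun y : Rn R n => tnth y i) @^-1` `[(tnth x i - L)%R, (tnth x i + L)%R])).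
  apply: fin_bigcap_measurable => //= i _.
  rewrite -[X in measurable X]setTI.
  exact: (measurable_tnth i measurableT (measurable_itv _)).
by apply/seteqP; split => y /= yx i; have := yx i;
  rewrite /= in_itv/= ler_distl => // ->.
Qed.

Lemma lebesgue_cube n (x : Rn R n) (L : R) : (0 < L)%R ->
  lebesgue_Rn n (cube x L) = ((2 * L) ^+ n)%:E.
Proof.
move=> L0; elim: n x => [|n ih] x /=.
  by rewrite diracE mem_set// => -[].
rewrite /lebesgue_step /pushforward.
rewrite (_ : consRn @^-1` cube x L =
    `[(thead x - L)%R, (thead x + L)%R] `*` cube [tuple of behead x] L).
  rewrite product_measure1E//; [|exact: measurable_cube].
  rewrite exprS EFinM; congr (_ * _); last exact: ih.
  rewrite [LHS](@lebesgue_measure_itv R `[_, _])/= lte_fin ler_ltD//; last lra.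
  by rewrite -EFinB; congr EFin; ring.
apply/seteqP; split => [[a y] /= ayx|[a y] /= [+ yx] i].
  split => [|i].
    by have := ayx ord0; rewrite tnth0 (tuple_eta x) tnth0 theadE in_itv/= ler_distl.
  have := ayx (lift ord0 i); rewrite !(tnth_nth a)/= nth_behead; exact.
rewrite in_itv/= -ler_distl => ax; have [j ->|->] := unliftP ord0 i.
  have := yx j; rewrite !(tnth_nth a)/= nth_behead; exact.
by rewrite tnth0 /thead.
Qed.

End lebesgue_cube.

Section spacetime_geometry.
Context {R : realType} {n : nat}.
Local Open Scope ereal_scope.
Local Notation st := (spacetime R n).
Local Notation mu := (@lebesgue_st R n).
Implicit Types (A B : set st) (f : st -> \bar R) (x y : Rn R n).

(** The sets over which [avg] is a genuine mean: dividing by a measure that is zero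
    or infinite is excluded. *)
Definition averageable A := measurable A /\ exists2 r : R, (0 < r)%R & mu A = r%:E.

Lemma measurable_cylinder x (L a b : R) (ba bb : bool) :
  measurable (cube x L `*` [set` Interval (BSide ba a) (BSide bb b)] : set st).
Proof. by apply: measurableX; [exact: measurable_cube|exact: measurable_itv]. Qed.

Lemma lebesgue_cylinder x (L a b : R) (ba bb : bool) : (0 < L)%R -> (a < b)%R ->
  mu (cube x L `*` [set` Interval (BSide ba a) (BSide bb b)]) =
  ((2 * L) ^+ n * (b - a))%:E.
Proof.
move=> L0 ab; rewrite [LHS]product_measure1E; [|exact: measurable_cube|exact: measurable_itv].
rewrite EFinM; congr (_ * _); first exact: lebesgue_cube.
by rewrite [LHS](@lebesgue_measure_itv R (Interval _ _))/= lte_fin ab.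
Qed.

Lemma averageable_cylinder x (L a b : R) (ba bb : bool) : (0 < L)%R -> (a < b)%R ->
  averageable (cube x L `*` [set` Interval (BSide ba a) (BSide bb b)]).
Proof.
move=> L0 ab; split; first exact: measurable_cylinder.
exists ((2 * L) ^+ n * (b - a))%R; last exact: lebesgue_cylinder.
by rewrite mulr_gt0 ?subr_gt0// exprn_gt0// mulr_gt0.
Qed.

Lemma cube_subset (x : Rn R n) (L L' : R) : (L <= L')%R -> cube x L `<=` cube x L'.
Proof. by move=> LL y yx i; exact: le_trans (yx i) LL. Qed.

Lemma cube_shift_subset (x y : Rn R n) (r L : R) :
  (forall i, `|tnth y i - tnth x i| <= L - r)%R -> cube y r `<=` cube x L.
Proof.
move=> xy z zy i; have := xy i; have := zy i; rewrite !ler_distl => /andP[? ?] /andP[? ?].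
by apply/andP; split; lra.
Qed.

Lemma translated_lowerE (p a tau : R) x (t L : R) : translated_lower p a tau x t L =
  cube x L `*` `](t + a * L `^ p - tau * (1 + a) * L `^ p)%R,
                 (t + L `^ p - tau * (1 + a) * L `^ p)%R[.
Proof.
apply/seteqP; split => [_ [[y s] [/= yx +] <-]|[y s] [/= yx +]]; rewrite !in_itv/=.
  by move=> ?; split => //=; rewrite !ltrD2r.
move=> /andP[s1 s2]; exists (y, s + tau * (1 + a) * L `^ p)%R => /=; last by rewrite addrK.
by split => //=; rewrite in_itv/=; apply/andP; split; lra.
Qed.

(** Closed in time, unlike the parabolic rectangles: the chains only need boxes that
    fit inside open rectangles with room to spare. *)
Definition box y (s r h : R) : set st := cube y r `*` `[(s - h)%R, (s + h)%R].

Lemma averageable_box y (s r h : R) : (0 < r)%R -> (0 < h)%R ->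
  averageable (box y s r h).
Proof. by move=> r0 h0; apply: averageable_cylinder => //; lra. Qed.

Lemma lebesgue_box y (s r h : R) : (0 < r)%R -> (0 < h)%R ->
  mu (box y s r h) = ((2 * r) ^+ n * (2 * h))%:E.
Proof.
move=> r0 h0; rewrite lebesgue_cylinder//; last lra.
by congr (_ * _)%:E; ring.
Qed.

Lemma box_grid_cover (x : Rn R n) (L a b h : R) (N M : nat) z : (0 < L)%R -> (a < b)%R ->
  (0 < N)%N -> (0 < M)%N -> ((b - a) / (2 * M%:R) <= h)%R ->
  cube x L z.1 -> (a <= z.2 <= b)%R ->
  exists j : {ffun 'I_n -> 'I_N} * 'I_M,
    box [tuple mesh N (tnth x i - L) (tnth x i + L) (j.1 i) | i < n]
      (mesh M a b j.2) (L / N%:R) h z.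
Proof.
move=> L0 ab N0 M0 bah zx zab.
have NR : (0 < N%:R :> R)%R by rewrite ltr0n.
have coord i : exists k : 'I_N,
    (`|tnth z.1 i - mesh N (tnth x i - L) (tnth x i + L) k| <= L / N%:R)%R.
  have := zx i; rewrite ler_distl => zxi.
  have [|k zk] := mesh_cover N0 _ zxi; first lra.
  exists k; apply: (le_trans zk); rewrite le_eqVlt; apply/orP; left; apply/eqP.
  by field; rewrite gt_eqF.
have [k zk] := mesh_cover M0 ab zab.
have [f zf] := choice coord.
exists ([ffun i => f i], k); split => /= [i|].
  by rewrite tnth_mktuple ffunE; exact: zf.
by rewrite in_itv/= -ler_distl (le_trans zk).
Qed.

Lemma avg_ge0 A f : (forall z, 0 <= f z) -> 0 <= avg A f.
Proof. by move=> f0; rewrite mule_ge0 ?inve_ge0// integral_ge0. Qed.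

(** A mean over [B] is bounded by means over a cover of [B]: each set of the cover
    counts with its measure relative to that of [B]. *)
Lemma avg_cover (J : finType) B (B_ : J -> set st) f (c : R) (Y : \bar R) :
  averageable B -> (forall j, averageable (B_ j)) -> (forall z, 0 <= f z) ->
  (0 <= c)%R -> (forall j, mu (B_ j) <= c%:E * mu B) ->
  (forall z, B z -> exists j, B_ j z) ->
  (forall j, avg (B_ j) f <= Y) -> avg B f <= (c * #|J|%:R)%:E * Y.
Proof.
move=> [mB [b b0 muB]] ndB f0 c0 muBj BB fY.
have le_int j : \int[mu]_(z in B_ j) f z <= (c * b)%:E * Y.
  have [mBj [r r0 muBjr]] := ndB j.
  have Y0 : 0 <= Y by apply: le_trans (fY j); exact: avg_ge0.
  move: (fY j); rewrite /avg muBjr inver gt_eqF// lee_pdivrMl//.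
  move=> /le_trans; apply; apply: lee_wpmul2r => //.
  by move: (muBj j); rewrite muBjr muB -EFinM.
rewrite /avg muB inver gt_eqF// lee_pdivrMl//.
apply: (le_trans (ge0_integral_cover mu (fun j => (ndB j).1) f0 BB)).
apply: (@le_trans _ _ (\sum_(j : J) (c * b)%:E * Y)); first exact: lee_sum.
rewrite -ge0_sume_distrl => [|j _]; last by rewrite lee_fin mulr_ge0// ltW.
rewrite sumEFin sumr_const muleA -EFinM.
by rewrite (_ : b * (c * _) = c * b *+ #|J|)%R// -mulr_natr; ring.
Qed.

End spacetime_geometry.

(** * The enlarged rectangle *)

Section dilation.
Context {R : realType}.
Local Open Scope ereal_scope.

(** With [L'^p = dilation * L^p] and a centre moved to the time
    [t + (1 - dilation) L^p], the lower part of [R(x, t', L')] starts exactly where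
    [S^-(alpha)] starts, and its upper part ends exactly where [R^+(alpha)] ends. *)
Definition dilation (alpha tau : R) : R := (1 + (1 + alpha) * (tau - 1) / 2)%R.

(** The measure of [R'^+-(gamma)] divided by the common measure of [S^-(alpha)] and
    [R^+(alpha)]. *)
Definition dilation_ratio (n : nat) (p gamma alpha tau : R) : R :=
  ((dilation alpha tau `^ p^-1) ^+ n * (dilation alpha tau * (1 - gamma)) /
   (1 - alpha))%R.

Lemma dilation_ge1 (alpha tau : R) : (0 <= alpha)%R -> (1 <= tau)%R ->
  (1 <= dilation alpha tau)%R.
Proof. by move=> ? ?; rewrite /dilation lerDl divr_ge0// mulr_ge0//; lra. Qed.

Lemma dilation_ratio_gt0 (n : nat) (p gamma alpha tau : R) : (0 <= alpha)%R -> (alpha < 1)%R ->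
  (gamma < 1)%R -> (1 <= tau)%R -> (0 < dilation_ratio n p gamma alpha tau)%R.
Proof.
move=> a0 a1 g1 t1; have d1 := dilation_ge1 a0 t1.
rewrite /dilation_ratio divr_gt0 ?subr_gt0// mulr_gt0//.
  by rewrite exprn_gt0// powR_gt0//; lra.
by apply: mulr_gt0; lra.
Qed.

End dilation.

(** * Lower means, and from the lag to the translated rectangles *)

Section one_sided_conditions.
Context {R : realType} {n : nat}.
Local Open Scope ereal_scope.
Local Notation st := (spacetime R n).
Local Notation mu := (@lebesgue_st R n).
Implicit Types (A B : set st) (w : st -> R) (m : set st -> \bar R) (x y : Rn R n).

(** A common form of [B |-> ess inf_B w] and of the negative power means of [w]. The
    bound on [m B] in terms of a cover plays for [m] the role of [avg_cover]; the
    constant [K] may depend only on the relative size and the number of the covering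
    sets, so that constants do not depend on [w]. *)
Definition lower_mean (K : R -> nat -> R) w m :=
  [/\ forall A, 0 <= m A,
      forall A, averageable A -> m A <= avg A (EFin \o w)
    & forall (J : finType) B (B_ : J -> set st) (c : R) (X : \bar R),
        averageable B -> (forall j, averageable (B_ j)) -> (0 < c)%R ->
        (forall j, mu (B_ j) <= c%:E * mu B) ->
        (forall z, B z -> exists j, B_ j z) ->
        (forall j, X <= m (B_ j)) -> X <= (K c #|J|)%:E * m B].

Section fixed_weight.
Variables (K : R -> nat -> R) (w : st -> R) (m : set st -> \bar R).
Hypotheses (K_gt0 : forall (c : R) N, (0 < c)%R -> (0 < N)%N -> (0 < K c N)%R).
Hypotheses (w_ge0 : forall z, (0 <= w z)%R) (mP : lower_mean K w m).

Let m_ge0 A : 0 <= m A. Proof. by case: mP. Qed.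

(** Both sides of a one-sided estimate pass to subsets of comparable measure, as a
    set is covered by the single set that contains it. *)
Lemma one_sided_subset (C c : R) A A' B B' : (0 <= C)%R -> (0 < c)%R ->
  averageable A -> averageable A' -> averageable B -> averageable B' ->
  A `<=` A' -> B `<=` B' -> mu A' <= c%:E * mu A -> mu B' <= c%:E * mu B ->
  avg A' (EFin \o w) <= C%:E * m B' ->
  avg A (EFin \o w) <= (c * K c 1 * C)%:E * m B.
Proof.
move=> C0 c0 ndA ndA' ndB ndB' AA BB muA muB H.
have w0 z : 0 <= (EFin \o w) z by rewrite lee_fin.
have := @avg_cover _ _ unit A (fun=> A') (EFin \o w) c _ ndA (fun=> ndA') w0 (ltW c0)
  (fun=> muA) (fun z Az => ex_intro _ tt (AA _ Az)) (fun=> H).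
rewrite card_unit mulr1 => /le_trans; apply.
have [_ _ mC] := mP.
have := mC unit B (fun=> B') c (m B') ndB (fun=> ndB') c0
  (fun=> muB) (fun z Bz => ex_intro _ tt (BB _ Bz)) (fun=> lexx _).
rewrite card_unit => mB.
rewrite (_ : (c * K c 1 * C)%:E = c%:E * (C%:E * (K c 1)%:E)); last first.
  by rewrite -!EFinM; congr EFin; ring.
rewrite -!muleA; apply: lee_wpmul2l; first by rewrite lee_fin ltW.
by apply: lee_wpmul2l; first by rewrite lee_fin.
Qed.

(** One rectangle of comparable size serves for both sets: its lower part contains
    the translated lower part, and its upper part contains the upper part. *)
Lemma one_sided_translated (p gamma alpha tau C : R) : (1 < p)%R ->
  (0 < gamma)%R -> (gamma <= alpha)%R -> (alpha < 1)%R -> (1 <= tau)%R -> (0 <= C)%R ->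
  (forall x (t L : R), (0 < L)%R -> avg (lower p gamma x t L) (EFin \o w) <=
    C%:E * m (upper p gamma x t L)) ->
  forall x (t L : R), (0 < L)%R ->
    avg (translated_lower p alpha tau x t L) (EFin \o w) <=
    (dilation_ratio n p gamma alpha tau * K (dilation_ratio n p gamma alpha tau) 1 * C)%:E *
      m (upper p alpha x t L).
Proof.
move=> p1 g0 ga a1 t1 C0 H x t L L0; have a0 : (0 <= alpha)%R by lra.
pose la := dilation alpha tau; have d1 : (1 <= la)%R := dilation_ge1 a0 t1.
have d0 : (0 < la)%R by lra.
set T := (L `^ p)%R; have T0 : (0 < T)%R by rewrite powR_gt0.
pose L' := (L * la `^ p^-1)%R; pose t' := (t + (1 - la) * T)%R.
have LL' : (L <= L')%R.
  have : (1 `^ p^-1 <= la `^ p^-1)%R by rewrite ge0_ler_powR ?nnegrE ?invr_ge0//; lra.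
  by rewrite powR1 => ?; rewrite ler_peMr// ltW.
have L'0 : (0 < L')%R by exact: lt_le_trans LL'.
have TL' : (L' `^ p)%R = (la * T)%R.
  rewrite powRM ?powR_ge0 ?ltW// -powRrM mulVf ?gt_eqF//; last lra.
  by rewrite powRr1 ?ltW// mulrC.
(* The time inclusion that needs gamma <= alpha: R'^-(gamma) must reach the end of
   S^-(alpha), and R'^+(gamma) must start before R^+(alpha). *)
have dg : (la * (1 + gamma) <= tau * (1 + alpha))%R.
  rewrite /la/dilation; have : (0 <= (1 + alpha) * (tau - 1) * (1 - gamma))%R.
    by rewrite !mulr_ge0//; lra.
  by nra.
have dgT : (la * (1 + gamma) * T <= tau * (1 + alpha) * T)%R.
  by rewrite ler_wpM2r// ltW.
have dT : (la * T = T + ((1 + alpha) * tau * T - (1 + alpha) * T) / 2)%R.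
  by rewrite /la/dilation; ring.
have dgT1 : (T <= la * T)%R by rewrite ler_peMl// ltW.
have gT : (gamma * T <= alpha * T)%R by rewrite ler_wpM2r// ltW.
have aT : (alpha * T < T)%R by rewrite gtr_pMl.
have gT1 : (gamma * (la * T) < la * T)%R.
  by rewrite gtr_pMl ?mulr_gt0//; lra.
rewrite translated_lowerE.
apply: (@one_sided_subset C (dilation_ratio n p gamma alpha tau) _ (lower p gamma x t' L')
  _ (upper p gamma x t' L')) => //.
- apply: dilation_ratio_gt0 => //; lra.
- by apply: averageable_cylinder => //; rewrite -/T; lra.
- by apply: averageable_cylinder => //; rewrite TL'; lra.
- by apply: averageable_cylinder => //; rewrite -/T; lra.
- by apply: averageable_cylinder => //; rewrite TL'; lra.
- move=> [y s] [/= yx]; rewrite in_itv/= => /andP[s1 s2].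
  split => /=; first exact: cube_subset yx.
  by rewrite in_itv/= TL' /t' -/T; apply/andP; split; rewrite -/T in s1 s2 *; lra.
- move=> [y s] [/= yx]; rewrite in_itv/= => /andP[s1 s2].
  split => /=; first exact: cube_subset yx.
  by rewrite in_itv/= TL' /t' -/T; apply/andP; split; rewrite -/T in s1 s2 *; lra.
- rewrite lebesgue_cylinder//; last by rewrite TL'; lra.
  rewrite lebesgue_cylinder//; last by rewrite -/T; lra.
  rewrite -EFinM lee_fin TL' -/T /L' /dilation_ratio -/la le_eqVlt; apply/orP; left; apply/eqP.
  by rewrite !exprMn; field; lra.
- rewrite lebesgue_cylinder//; last by rewrite TL'; lra.
  rewrite lebesgue_cylinder//; last by rewrite -/T; lra.
  rewrite -EFinM lee_fin TL' -/T /L' /dilation_ratio -/la le_eqVlt; apply/orP; left; apply/eqP.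
  by rewrite !exprMn; field; lra.
- exact: H.
Qed.

(** * Chains of boxes: from the translated rectangles to the lag *)

(** The rectangle of side length [2 r] centred so that the box of [y] and [s] is in
    the middle of its translated lower part. A box takes half of its width and a
    quarter of its duration, which leaves room [r] in space and [(1 - alpha) T / 4]
    in time for the position of the second box in the upper part. *)
Lemma one_sided_box_step (p alpha tau C r : R) : (0 < r)%R ->
  (alpha < 1)%R -> (0 <= C)%R ->
  (forall x (t L : R), (0 < L)%R -> avg (translated_lower p alpha tau x t L) (EFin \o w) <=
    C%:E * m (upper p alpha x t L)) ->
  let T := ((2 * r) `^ p)%R in let h := ((1 - alpha) * T / 8)%R in
  forall y y' (s s' : R), (forall i, `|tnth y' i - tnth y i| <= r)%R ->
    (`|s' - s - tau * (1 + alpha) * T| <= (1 - alpha) * T / 4)%R ->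
    avg (box y s r h) (EFin \o w) <=
    (2 ^+ n * 4 * K (2 ^+ n * 4)%R 1 * C)%:E * m (box y' s' r h).
Proof.
move=> r0 a1 C0 H T h y y' s s' yy'; rewrite ler_distl => /andP[ss1 ss2].
have l0 : (0 < 2 * r)%R by lra.
have T0 : (0 < T)%R by rewrite powR_gt0.
have aT : (0 < (1 - alpha) * T)%R by rewrite mulr_gt0//; lra.
have h0 : (0 < h)%R by rewrite /h; lra.
pose t := (s - (1 + alpha) / 2 * T + tau * (1 + alpha) * T)%R.
have c0 : (0 < 2 ^+ n * 4 :> R)%R by rewrite mulr_gt0// exprn_gt0.
have muB y1 (s1 a b : R) (b1 b2 : bool) : (b - a = (1 - alpha) * T)%R ->
    mu (cube y (2 * r) `*` [set` Interval (BSide b1 a) (BSide b2 b)]) <=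
    (2 ^+ n * 4)%:E * mu (box y1 s1 r h).
  move=> ab; rewrite lebesgue_box// lebesgue_cylinder//; last by rewrite -subr_gt0 ab.
  rewrite -EFinM lee_fin ab le_eqVlt; apply/orP; left; apply/eqP.
  by rewrite !exprMn /h; field.
apply: (one_sided_subset C0 c0 _ _ _ _ _ _ _ _ (H y t (2 * r)%R l0)).
- exact: averageable_box.
- rewrite translated_lowerE; apply: averageable_cylinder => //; rewrite -/T; lra.
- exact: averageable_box.
- apply: averageable_cylinder => //; rewrite -/T; lra.
- rewrite translated_lowerE => -[z u] [/= zy]; rewrite in_itv/= => /andP[u1 u2].
  split => /=; first by apply: cube_subset zy; lra.
  by rewrite in_itv/= /t -/T; rewrite /h in u1 u2; apply/andP; split; lra.
- move=> -[z u] [/= zy]; rewrite in_itv/= => /andP[u1 u2].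
  split => /=; first by apply: cube_shift_subset zy => i; have := yy' i; lra.
  by rewrite in_itv/= /t -/T; rewrite /h in u1 u2; apply/andP; split; lra.
- by rewrite translated_lowerE; apply: muB; rewrite -/T; ring.
- by apply: muB; rewrite -/T; ring.
Qed.

(** The displacement is spread evenly over the steps; [m <= avg] turns the bound by
    [m] at the end of one step into the bound by an average that starts the next. *)
Lemma one_sided_box_chain (C r h D e : R) (k : nat) : (0 < r)%R -> (0 < h)%R -> (0 <= C)%R ->
  (forall y y' (s s' : R), (forall i, `|tnth y' i - tnth y i| <= r)%R ->
    (`|s' - s - D| <= e)%R ->
    avg (box y s r h) (EFin \o w) <= C%:E * m (box y' s' r h)) ->
  forall y y' (s s' : R), (forall i, `|tnth y' i - tnth y i| <= k.+1%:R * r)%R ->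
    (`|s' - s - k.+1%:R * D| <= k.+1%:R * e)%R ->
    avg (box y s r h) (EFin \o w) <= (C ^+ k.+1)%:E * m (box y' s' r h).
Proof.
move=> r0 h0 C0 step; elim: k => [|k ih] y y' s s' yy' ss'.
  by rewrite expr1; apply: step => [i|]; have := ss'; have := yy'; rewrite !mul1r; exact.
have kE : (k.+2%:R = k.+1%:R + 1 :> R)%R by rewrite -natr1.
have k0 : (0 < k.+2%:R :> R)%R by [].
have k1 : (0 <= k.+1%:R :> R)%R by [].
have norm_div (u v : R) : (`|u| <= k.+2%:R * v -> `|u / k.+2%:R| <= v)%R.
  by move=> uv; rewrite normrM normfV (gtr0_norm k0) ler_pdivrMr// mulrC.
pose y1 : Rn R n := [tuple (tnth y i + (tnth y' i - tnth y i) / k.+2%:R)%R | i < n].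
pose s1 := (s + (s' - s) / k.+2%:R)%R.
apply: (@le_trans _ _ (C%:E * m (box y1 s1 r h))).
  apply: step => [i|].
    by rewrite tnth_mktuple addrAC subrr add0r norm_div.
  rewrite (_ : s1 - s - D = (s' - s - k.+2%:R * D) / k.+2%:R)%R; last first.
    by rewrite /s1; field.
  by rewrite norm_div.
rewrite exprS EFinM -muleA; apply: lee_wpmul2l; first by rewrite lee_fin.
have [_ m_le_avg _] := mP; apply: (le_trans (m_le_avg _ _)).
  exact: averageable_box.
apply: ih => [i|].
  rewrite tnth_mktuple (_ : _ - _ = (tnth y' i - tnth y i) / k.+2%:R * k.+1%:R)%R; last first.
    by rewrite kE; field; apply: lt0r_neq0; have := ler0n R k; lra.
  rewrite normrM [X in (_ * X)%R]ger0_norm// mulrC ler_wpM2l//.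
  by rewrite norm_div.
rewrite (_ : _ - _ = (s' - s - k.+2%:R * D) / k.+2%:R * k.+1%:R)%R; last first.
  by rewrite /s1 kE; field; apply: lt0r_neq0; have := ler0n R k; lra.
rewrite normrM [X in (_ * X)%R]ger0_norm// mulrC ler_wpM2l//.
by rewrite norm_div.
Qed.

(** Any two boxes whose time difference is between [2 g L^p] and [2 L^p] and whose
    distance in space is at most [2 L] are joined by a chain. The number of steps is
    bounded independently of [L], by the number of steps of duration
    [tau (1 + alpha) l^p] in [2 L^p], where [l = 2 L / N] and [l^p = th L^p]. *)
Lemma one_sided_far_boxes (p g alpha tau C th : R) (N : nat) : (0 < N)%N ->
  (0 < g)%R -> (0 <= alpha)%R -> (alpha < 1)%R -> (1 <= tau)%R -> (0 <= C)%R ->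
  (th = 2 `^ p / N%:R `^ p)%R ->
  (2 * N%:R + tau * (1 + alpha) / ((1 - alpha) / 4) + 1 <=
    2 * g / (tau * (1 + alpha) * th))%R ->
  (forall x (t L : R), (0 < L)%R -> avg (translated_lower p alpha tau x t L) (EFin \o w) <=
    C%:E * m (upper p alpha x t L)) ->
  exists2 C' : R, (0 < C')%R & forall (L : R) y y' (s s' : R), (0 < L)%R ->
    (forall i, `|tnth y' i - tnth y i| <= 2 * L)%R ->
    (2 * g * L `^ p <= s' - s)%R -> (s' - s <= 2 * L `^ p)%R ->
    avg (box y s (L / N%:R) ((1 - alpha) * (th * L `^ p) / 8)) (EFin \o w) <=
    C'%:E * m (box y' s' (L / N%:R) ((1 - alpha) * (th * L `^ p) / 8)).
Proof.
move=> N0 g0 a0 a1 t1 C0 thE Ng H.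
have NR : (0 < N%:R :> R)%R by rewrite ltr0n.
have th0 : (0 < th)%R by rewrite thE divr_gt0 ?powR_gt0.
have ta0 : (0 < tau * (1 + alpha))%R by rewrite mulr_gt0//; lra.
pose C1 : R := Num.max 1%R (2 ^+ n * 4 * K (2 ^+ n * 4)%R 1 * C)%R.
have C1_ge1 : (1 <= C1)%R by rewrite le_max lexx.
have C1_gt0 : (0 < C1)%R by exact: lt_le_trans C1_ge1.
pose d : R := (tau * (1 + alpha) * th)%R; have d0 : (0 < d)%R by rewrite mulr_gt0.
pose e : R := ((1 - alpha) / 4 * th)%R.
have e0 : (0 < e)%R by rewrite mulr_gt0// divr_gt0//; lra.
have de : (d / e = tau * (1 + alpha) / ((1 - alpha) / 4))%R.
  by rewrite /d /e; field; rewrite !gt_eqF//; lra.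
rewrite -de in Ng.
exists (C1 ^+ Num.trunc (2 / d))%R; first by rewrite exprn_gt0.
move=> L y y' s s' L0 yy' ss1 ss2.
set r : R := (L / N%:R)%R; set h : R := (_ / 8)%R.
have T0 : (0 < L `^ p)%R by rewrite powR_gt0.
have r0 : (0 < r)%R by rewrite divr_gt0.
have h0 : (0 < h)%R by rewrite divr_gt0 ?mulr_gt0 ?subr_gt0.
have rT : ((2 * r) `^ p = th * L `^ p)%R.
  rewrite thE /r mulrA mulrAC powRM// ?divr_ge0 ?ltW// powRM ?invr_ge0 ?ltW//.
  by rewrite -(powR_inv1 (ltW NR)) powRAC powR_inv1 ?powR_ge0.
have [k [kmax kN kd]] : exists k : nat, [/\ (k.+1 <= Num.trunc (2 / d))%N,
    (2 * N%:R <= k.+1%:R :> R)%R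
    & (`|(s' - s) / L `^ p - k.+1%:R * d| <= k.+1%:R * e)%R].
  by apply: (step_count d0 e0 (ltW NR) Ng); rewrite ?ler_pdivlMr ?ler_pdivrMr.
apply: (@le_trans _ _ ((C1 ^+ k.+1)%:E * m (box y' s' r h))); last first.
  by apply: lee_wpmul2r => //; rewrite lee_fin ler_weXn2l.
apply: (@one_sided_box_chain C1 r h (d * L `^ p) (e * L `^ p) k r0 h0 (ltW C1_gt0)).
- move=> z z' u u' zz' uu'; have := @one_sided_box_step p alpha tau C r r0 a1 C0 H.
  rewrite /= rT => /(_ z z' u u' zz').
  rewrite (_ : tau * (1 + alpha) * (th * L `^ p) = d * L `^ p)%R; last by rewrite mulrA.
  rewrite (_ : (1 - alpha) * (th * L `^ p) / 4 = e * L `^ p)%R; last by rewrite /e; field.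
  move=> /(_ uu') /le_trans; apply; apply: lee_wpmul2r => //.
  by rewrite lee_fin le_max lexx orbT.
- move=> i; apply: (le_trans (yy' i)).
  rewrite (_ : 2 * L = 2 * N%:R * r)%R; last by rewrite /r; field; rewrite gt_eqF.
  by rewrite ler_wpM2r// ltW.
- have -> : (s' - s = (s' - s) / L `^ p * L `^ p)%R by rewrite divfK// gt_eqF.
  by rewrite (mulrA _ d) (mulrA _ e) -mulrBl normrM (gtr0_norm T0) ler_wpM2r ?(ltW T0)//.
Qed.

(** Grids of equal boxes cover the lower and the upper part. The estimate for every
    pair of boxes passes to the average on the left by [avg_cover], and to [m] on the
    right by the cover property of a lower mean. *)
Lemma one_sided_lag (p gamma alpha tau C : R) : (1 < p)%R ->
  (0 < gamma)%R -> (gamma < 1)%R -> (0 <= alpha)%R -> (alpha < 1)%R -> (1 <= tau)%R ->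
  (0 <= C)%R ->
  (forall x (t L : R), (0 < L)%R -> avg (translated_lower p alpha tau x t L) (EFin \o w) <=
    C%:E * m (upper p alpha x t L)) ->
  exists2 C' : R, (0 < C')%R & forall x (t L : R), (0 < L)%R ->
    avg (lower p gamma x t L) (EFin \o w) <= C'%:E * m (upper p gamma x t L).
Proof.
move=> p1 g0 g1 a0 a1 t1 C0 H.
have [N N0 Ng] : exists2 N : nat, (0 < N)%N &
    (2 * N%:R + tau * (1 + alpha) / ((1 - alpha) / 4) + 1 <=
     2 * gamma / (tau * (1 + alpha) * (2 `^ p / N%:R `^ p)))%R.
  apply: (small_scale p1 _ _ g0); first by rewrite mulr_gt0//; lra.
  by rewrite divr_gt0//; lra.
have NR : (0 < N%:R :> R)%R by rewrite ltr0n.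
have [C2 C20 far] := one_sided_far_boxes N0 g0 a0 a1 t1 C0 erefl Ng H.
move: (2 `^ p / N%:R `^ p)%R (divr_gt0 (powR_gt0 p (@ltr0Sn R 1)) (powR_gt0 p NR)) far.
move=> th th0 far {Ng}.
pose ka : R := ((1 - alpha) * th / 8)%R.
have ka0 : (0 < ka)%R by rewrite divr_gt0// mulr_gt0// subr_gt0.
(* Enough time intervals for the half-length of a mesh cell to be at most that of a
   box. *)
pose M := (Num.trunc ((1 - gamma) / (2 * ka))).+1.
have M0 : (0 < M)%N by [].
have Mka : ((1 - gamma) / (2 * M%:R) <= ka)%R.
  have := truncnS_gt ((1 - gamma) / (2 * ka)); rewrite -/M => /ltW.
  have k2 : (0 < 2 * ka)%R by rewrite mulr_gt0.
  have M2 : (0 < 2 * M%:R :> R)%R by rewrite mulr_gt0.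
  rewrite (ler_pdivrMr _ _ k2) (ler_pdivrMr _ _ M2) => MM.
  by rewrite (_ : ka * (2 * M%:R) = M%:R * (2 * ka))%R; last by ring.
pose J : finType := ({ffun 'I_n -> 'I_N} * 'I_M)%type.
have J0 : (0 < #|J|)%N.
  by apply/card_gt0P; exists ([ffun=> Ordinal N0], Ordinal M0).
(* The measure of a box divided by the common measure of R^-(gamma) and R^+(gamma). *)
pose rho : R := ((N%:R^-1) ^+ n * (2 * ka) / (1 - gamma))%R.
have rho0 : (0 < rho)%R.
  by rewrite divr_gt0 ?subr_gt0// mulr_gt0 ?exprn_gt0 ?invr_gt0// mulr_gt0.
have rJC0 : (0 < rho * #|J|%:R * C2)%R.
  by apply: mulr_gt0 => //; apply: mulr_gt0 => //; rewrite ltr0n.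
exists (rho * #|J|%:R * C2 * K rho #|J|)%R.
  by apply: mulr_gt0 => //; exact: K_gt0.
move=> x t L L0.
set T : R := (L `^ p)%R; have T0 : (0 < T)%R by rewrite powR_gt0.
pose r : R := (L / N%:R)%R; have r0 : (0 < r)%R by rewrite divr_gt0.
pose h : R := (ka * T)%R; have h0 : (0 < h)%R by rewrite mulr_gt0.
have gT : (gamma * T < T)%R by rewrite gtr_pMl.
have gT0 : (0 < gamma * T)%R by rewrite mulr_gt0.
pose yc (j : J) : Rn R n := [tuple mesh N (tnth x i - L) (tnth x i + L) (j.1 i) | i < n].
pose sm (j : J) := mesh M (t - T) (t - gamma * T) j.2.
pose sp (j : J) := mesh M (t + gamma * T) (t + T) j.2.
have chain j j' : avg (box (yc j) (sm j) r h) (EFin \o w) <=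
    C2%:E * m (box (yc j') (sp j') r h).
  have /andP[sm1 sm2] : (t - T <= sm j <= t - gamma * T)%R.
    by apply: mesh_itv; lra.
  have /andP[sp1 sp2] : (t + gamma * T <= sp j' <= t + T)%R.
    by apply: mesh_itv; lra.
  have -> : h = ((1 - alpha) * (th * L `^ p) / 8)%R by rewrite /h /ka -/T; ring.
  apply: far => //; rewrite -/T; last 2 first.
  - by lra.
  - by lra.
  move=> i; have LL : (tnth x i - L <= tnth x i + L)%R by lra.
  have /andP[] := mesh_itv (j.1 i) LL; have /andP[] := mesh_itv (j'.1 i) LL.
  by rewrite !tnth_mktuple ler_distl; move=> ? ? ? ?; apply/andP; split; lra.
have mubox y s : mu (box y s r h) = (rho * ((2 * L) ^+ n * ((1 - gamma) * T)))%:E.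
  rewrite lebesgue_box//; congr (_%:E); rewrite /rho /h.
  rewrite (_ : 2 * r = (2 * L) * N%:R^-1)%R; last by rewrite /r mulrA.
  rewrite [in LHS]exprMn; move: ((2 * L) ^+ n)%R (N%:R^-1 ^+ n)%R => P Q.
  by field; lra.
have mulow : mu (lower p gamma x t L) = ((2 * L) ^+ n * ((1 - gamma) * T))%:E.
  rewrite lebesgue_cylinder//; last by rewrite -/T; lra.
  by rewrite -/T; congr (_%:E); ring.
have muup : mu (upper p gamma x t L) = ((2 * L) ^+ n * ((1 - gamma) * T))%:E.
  rewrite lebesgue_cylinder//; last by rewrite -/T; lra.
  by rewrite -/T; congr (_%:E); ring.
have low_cover z : lower p gamma x t L z -> exists j, box (yc j) (sm j) r h z.
  move=> [zx]; rewrite /= in_itv/= -/T => /andP[z1 z2].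
  apply: box_grid_cover => //; first by lra.
    rewrite (_ : t - gamma * T - (t - T) = (1 - gamma) * T)%R; last by ring.
    by rewrite mulrAC ler_wpM2r// ltW.
  by rewrite !ltW.
have up_cover z : upper p gamma x t L z -> exists j, box (yc j) (sp j) r h z.
  move=> [zx]; rewrite /= in_itv/= -/T => /andP[z1 z2].
  apply: box_grid_cover => //; first by lra.
    rewrite (_ : t + T - (t + gamma * T) = (1 - gamma) * T)%R; last by ring.
    by rewrite mulrAC ler_wpM2r// ltW.
  by rewrite !ltW.
have avg_low j' : avg (lower p gamma x t L) (EFin \o w) <=
    (rho * #|J|%:R * C2)%:E * m (box (yc j') (sp j') r h).
  rewrite EFinM -muleA; apply: (avg_cover _ _ _ _ _ low_cover) => //.
  - by apply: averageable_cylinder => //; rewrite -/T; lra.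
  - by move=> j; exact: averageable_box.
  - exact: ltW rho0.
  - by move=> j; rewrite mubox mulow -EFinM.
have [_ _ mC] := mP.
have : (rho * #|J|%:R * C2)^-1%:E * avg (lower p gamma x t L) (EFin \o w) <=
    (K rho #|J|)%:E * m (upper p gamma x t L).
  apply: (mC _ _ (fun j => box (yc j) (sp j) r h)) => //.
  - by apply: averageable_cylinder => //; rewrite -/T; lra.
  - by move=> j; exact: averageable_box.
  - by move=> j; rewrite mubox muup -EFinM.
  - by move=> j; rewrite lee_pdivrMl.
by rewrite lee_pdivrMl// muleA -EFinM.
Qed.

End fixed_weight.

End one_sided_conditions.

(** * Borel representatives of Lebesgue measurable functions *)

Section lower_means.
Context {R : realType} {n : nat}.
Local Open Scope ereal_scope.
Local Notation st := (spacetime R n).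
Local Notation mu := (@lebesgue_st R n).
Implicit Types (A B : set st) (w : st -> R).

(** Each superlevel set at a rational height is Borel up to a null set, and [M] collects
    these countably many null sets; rational heights suffice to generate. *)
Lemma lebesgue_measurable_borel w : lebesgue_measurable_fun w ->
  exists M : set st, [/\ measurable M, mu M = 0 & measurable_fun (~` M) w].
Proof.
move=> mw; pose rho k : R := ratr (odflt 0%R (unpickle k : option rat)).
have /choice[AN] : forall k, exists AN : set st * set st,
    [/\ measurable AN.1, mu.-negligible AN.2 & w @^-1` `]rho k, +oo[ = AN.1 `|` AN.2].
  move=> k; have [A mA [N nN AN]] := mw _ (measurable_itv `]rho k, +oo[).
  by exists (A, N).
move=> /all_and3[mA nN wE].
have [M [mM M0 NM]] := negligible_bigcup nN.
exists M; split => // mMC; apply: (measurability _ (RGenOInfty.measurableE R)) => //.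
move=> /= _ [_ [x ->] <-].
rewrite (_ : _ `&` _ = \bigcup_k (if (x < rho k)%R then ~` M `&` (AN k).1 else set0)).
  apply: bigcup_measurable => k _; case: ifP => _ //.
  exact: measurableI.
apply/seteqP; split => z /=.
  move=> [Mz]; rewrite in_itv/= andbT => xw.
  have [r] := rat_in_itvoo xw; rewrite in_itv/= => /andP[xr rw].
  have rE : rho (pickle r) = ratr r by rewrite /rho pickleK.
  exists (pickle r) => //; rewrite rE xr; split => //.
  have : (w @^-1` `]rho (pickle r), +oo[) z by rewrite /= in_itv/= andbT rE.
  by rewrite wE => -[//|Nz]; exfalso; apply: Mz; apply: NM; exists (pickle r).
move=> [k _]; case: ifPn => // xk [Mz Az]; split => //.
have : (w @^-1` `]rho k, +oo[) z by rewrite wE; left.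
by rewrite /= !in_itv/= !andbT; exact: lt_trans.
Qed.

Lemma measure_setD_null (A M : set st) : measurable A -> measurable M -> mu M = 0 ->
  mu (A `\` M) = mu A.
Proof.
move=> mA mM M0; rewrite [in RHS](measureDI mu mA mM).
rewrite [X in _ + X](@subset_measure0 _ _ _ mu _ M) ?adde0//.
exact: measurableI.
Qed.

(** * Essential infimum and power mean as lower means *)

Lemma ess_inf_on_le_avg w (A : set st) : (forall z, 0 <= w z)%R ->
  averageable A ->
  ess_inf_on A w <= avg A (EFin \o w).
Proof.
move=> w0 [mA [a a0 muA]].
have [N [mN N0 Nw]] := @ess_inf_le _ _ _ mu (patch (cst +oo) A (EFin \o w)).
rewrite /ess_inf_on; move: Nw; set e := ess_inf _ _ => Nw.
have ew z : (A `\` N) z -> e <= (w z)%:E.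
  move=> [Az Nz]; apply: contrapT => ewz; apply: Nz; apply: Nw => /=.
  by rewrite /patch mem_set.
have muAN : mu (A `\` N) = a%:E by rewrite measure_setD_null.
have [|e0] := leP e 0.
  by move=> /le_trans; apply; apply: avg_ge0 => z; rewrite lee_fin.
have {}e0 : 0 <= e by exact: ltW.
rewrite /avg muA inver gt_eqF// lee_pdivlMl// muleC -muAN.
rewrite -(integral_cst mu (measurableD mA mN)).
exact: ge0_le_integral_sub.
Qed.

(** No constant is lost on a cover: the exceptional null sets of its finitely many
    members have a null union. *)
Lemma lower_mean_ess_inf w : (forall z, 0 <= w z)%R ->
  lower_mean (fun _ _ => 1%R) w (fun A => ess_inf_on A w).
Proof.
move=> w0; split.
- move=> A; apply/ess_infP/nearW => z; rewrite /patch; case: ifP => //= _.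
  by rewrite lee_fin.
- by move=> A; exact: ess_inf_on_le_avg.
- move=> J B B_ c X ndB _ c0 _ BB XB; rewrite mul1e; apply/ess_infP.
  have : \forall z \ae mu, forall j, X <= patch (cst +oo) (B_ j) (EFin \o w) z.
    by apply: filter_forall => j; apply/ess_infP/XB.
  apply: filterS => z Xz; rewrite {1}/patch; case: ifPn => [/set_mem Bz|_].
    by have [j Bj] := BB _ Bz; have := Xz j; rewrite /patch mem_set.
  by rewrite leey.
Qed.

(** Bernoulli's inequality for a negative exponent. *)
Lemma bernoulli_powR (x s : R) : (0 < x)%R -> (0 < s)%R ->
  (1 + s - s * x <= x `^ (- s))%R.
Proof.
move=> x0 s0; rewrite /powR gt_eqF//; apply: le_trans (expR_ge1Dx _).
have : (ln x <= x - 1)%R by rewrite -ler_expR lnK ?posrE// (le_trans _ (expR_ge1Dx _))//; lra.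
by nra.
Qed.

(** With [s = 1 / (q - 1)], the convex function [u |-> u^(-s)] lies above its tangent
    line at [c]; where [w] vanishes the dual weight is [+oo]. *)
Lemma tangent_dual_weight q w (c s : R) z : (0 < s)%R -> (s * (q - 1) = 1)%R ->
  (0 < c)%R -> (0 <= w z)%R ->
  (c `^ (- s) * (1 + s) - c `^ (- s) * (s / c) * w z)%:E <= dual_weight q w z.
Proof.
move=> s0 sq c0 wz0; rewrite /dual_weight; case: eqP => [_|/eqP wz]; first by rewrite leey.
have q1 : (q - 1 != 0)%R by apply: contra_eq_neq sq => ->; rewrite mulr0 eq_sym oner_neq0.
have {wz0 wz} wz0 : (0 < w z)%R by rewrite lt0r wz.
have -> : (1 / (1 - q) = - s)%R by apply: (mulIf q1); rewrite mulNr sq; field; rewrite -opprB oppr_eq0.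
rewrite lee_fin; have wc0 : (0 < w z / c)%R by rewrite divr_gt0.
have := bernoulli_powR wc0 s0.
have : w z = (w z / c * c)%R by rewrite divfK// gt_eqF.
move: (w z / c)%R wc0 => x x0 -> H.
have cs0 : (0 < c `^ (- s))%R by rewrite powR_gt0.
have -> : ((x * c) `^ (- s) = x `^ (- s) * c `^ (- s))%R by rewrite powRM//; exact: ltW.
have -> : (c `^ (- s) * (1 + s) - c `^ (- s) * (s / c) * (x * c) =
   (1 + s - s * x) * c `^ (- s))%R by field; rewrite gt_eqF.
by rewrite ler_wpM2r ?(ltW cs0).
Qed.

Lemma dual_weight_ge0 q w z : 0 <= dual_weight q w z.
Proof. by rewrite /dual_weight; case: eqP => // _; rewrite lee_fin powR_ge0. Qed.

(** Jensen's inequality, by integrating the tangent line at [c]. Taking for [c] a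
    positive upper bound of the average, instead of the average, covers a weight whose
    average is zero. *)
Lemma avg_dual_weight_ge q w (c s : R) (A : set st) :
  (forall z, 0 <= w z)%R -> lebesgue_measurable_fun w -> averageable A ->
  (0 < s)%R -> (s * (q - 1) = 1)%R -> (0 < c)%R -> avg A (EFin \o w) <= c%:E ->
  (c `^ (- s))%:E <= avg A (dual_weight q w).
Proof.
move=> w0 mw [mA [a a0 muA]] s0 sq c0.
rewrite /avg muA inver gt_eqF// lee_pdivrMl// lee_pdivlMl// -EFinM => wac.
have [M [mM M0 mwM]] := lebesgue_measurable_borel mw.
have mD : measurable (A `\` M) by exact: measurableD.
have muD : mu (A `\` M) = a%:E by rewrite measure_setD_null.
have mwD : measurable_fun (A `\` M) w.
  by apply: measurable_funS mwM; [exact: measurableC|exact: subDsetr].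
set l := (c `^ (- s))%R; have l0 : (0 < l)%R by rewrite powR_gt0.
pose k : R := (l * (s / c))%R; have k0 : (0 <= k)%R by rewrite mulr_ge0 ?divr_ge0 ?ltW.
(* The positive part of the tangent line: it is still below the dual weight, and the
   integral is additive for nonnegative integrands without integrability. *)
pose g z : R := Num.max 0%R (l * (1 + s) - k * w z)%R.
have mkw : measurable_fun (A `\` M) (fun z => k * w z)%R by exact: measurable_funM.
have mg : measurable_fun (A `\` M) g.
  apply: measurable_maxr => //; exact: measurable_funB.
have intg : \int[mu]_(z in A `\` M) (g z)%:E <= \int[mu]_(z in A) dual_weight q w z.
  apply: ge0_le_integral_sub.
  - exact: subDsetl.
  - by move=> z; rewrite lee_fin le_max lexx.
  - exact: dual_weight_ge0.
  - move=> z _; rewrite /g EFin_max ge_max dual_weight_ge0/=.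
    exact: tangent_dual_weight.
have intw : \int[mu]_(z in A `\` M) (w z)%:E <= (a * c)%:E.
  by apply: le_trans wac; apply: ge0_le_integral_sub.
have : (l * (1 + s) * a)%:E <=
    \int[mu]_(z in A `\` M) (g z)%:E + k%:E * \int[mu]_(z in A `\` M) (w z)%:E.
  have g0 z : 0 <= (g z)%:E by rewrite lee_fin /g le_max lexx.
  have kw0 z : 0 <= k%:E * (w z)%:E by rewrite lee_fin mulr_ge0.
  have mgE : measurable_fun (A `\` M) (EFin \o g) by exact/measurable_EFinP.
  have mwE : measurable_fun (A `\` M) (EFin \o w) by exact/measurable_EFinP.
  have mkwE : measurable_fun (A `\` M) (fun z => k%:E * (w z)%:E).
    by apply: emeasurable_funM => //; exact: measurable_cst.
  have <- : \int[mu]_(z in A `\` M) (k%:E * (w z)%:E) =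
      k%:E * \int[mu]_(z in A `\` M) (w z)%:E.
    by apply: ge0_integralZl_EFin => // z _; rewrite lee_fin.
  rewrite -(ge0_integralD mu mD (fun z _ => g0 z) mgE (fun z _ => kw0 z) mkwE).
  rewrite EFinM -muD -(integral_cst mu mD).
  apply: ge0_le_integral_sub => //= [z|z|z _].
  - by rewrite lee_fin !mulr_ge0//; lra.
  - exact: adde_ge0.
  - by rewrite -EFinM -EFinD lee_fin -lerBlDr /g le_max lexx orbT.
have kac : k%:E * \int[mu]_(z in A `\` M) (w z)%:E <= (l * s * a)%:E.
  have -> : (l * s * a = k * (a * c))%R by rewrite /k; field; rewrite gt_eqF.
  by rewrite (EFinM k); apply: lee_wpmul2l; rewrite // lee_fin.
move=> /le_trans/(_ (leeD intg kac)).
rewrite -leeBlDr// -EFinB (_ : _ - _ = a * l)%R//.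
by ring.
Qed.

Lemma le_poweR (x y : \bar R) (r : R) : (0 <= r)%R -> 0 <= x -> x <= y ->
  poweR x r <= poweR y r.
Proof.
move=> r0 x0 xy; apply: gt0_ler_poweR => //; rewrite in_itv/= leey andbT//.
exact: le_trans xy.
Qed.

(** The power mean of [w] with exponent [-1 / (q - 1)]. The inverse is that of extended
    reals, so the mean is zero when the dual weight is not integrable. *)
Definition dual_mean q w (A : set st) : \bar R :=
  (poweR (avg A (dual_weight q w)) (q - 1))^-1.

Lemma dual_mean_le_avg q w (A : set st) : (1 < q)%R ->
  (forall z, 0 <= w z)%R -> lebesgue_measurable_fun w -> averageable A ->
  dual_mean q w A <= avg A (EFin \o w).
Proof.
move=> q1 w0 mw avA.
have avg0 : 0 <= avg A (EFin \o w) by apply: avg_ge0 => z; rewrite lee_fin.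
have [avgy|avgy] := eqVneq (avg A (EFin \o w)) +oo; first by rewrite avgy leey.
have avgfin : avg A (EFin \o w) \is a fin_num by rewrite ge0_fin_numE// ltey.
apply/lee_addgt0Pr => e e0; rewrite -(fineK avgfin) -EFinD.
set c := (_ + e)%R; have c0 : (0 < c)%R by rewrite ltr_wpDl// fine_ge0.
have q0 : (0 < q - 1)%R by rewrite subr_gt0.
have s0 : (0 < (q - 1)^-1)%R by rewrite invr_gt0.
have sq : ((q - 1)^-1 * (q - 1) = 1)%R by rewrite mulVf// gt_eqF.
have avgc : avg A (EFin \o w) <= c%:E.
  by rewrite -(fineK avgfin) lee_fin lerDl ltW.
have H := avg_dual_weight_ge w0 mw avA s0 sq c0 avgc.
have -> : c%:E = (poweR (c `^ - (q - 1)^-1)%:E (q - 1))^-1.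
  by rewrite poweR_EFin -powRrM mulNr sq powR_inv1 ?ltW// inver gt_eqF ?invr_gt0// invrK.
rewrite /dual_mean lee_pV2 ?inE ?poweR_ge0//.
by apply: le_poweR => //; [exact: ltW|rewrite lee_fin powR_ge0].
Qed.

(** A lower bound on the dual means of the covering sets is an upper bound on the
    averages of the dual weight there, to which [avg_cover] applies. *)
Lemma lower_mean_dual q w : (1 < q)%R -> weight w ->
  lower_mean (fun c N => (c * N%:R) `^ (q - 1))%R w (dual_mean q w).
Proof.
move=> q1 [w0 [mw _]]; have q0 : (0 < q - 1)%R by rewrite subr_gt0.
have s0 x : 0 <= avg x (dual_weight q w) by apply: avg_ge0; exact: dual_weight_ge0.
split.
- by move=> A; rewrite inve_ge0 poweR_ge0.
- by move=> A; exact: dual_mean_le_avg.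
- move=> J B B_ c X avB avB_ c0 muB BB XB.
  have [X0|X0] := leP X 0.
    by rewrite (le_trans X0)// mule_ge0 ?lee_fin ?powR_ge0// inve_ge0 poweR_ge0.
  have XV0 : 0 <= X^-1 by rewrite inve_ge0 ltW.
  have J0 : (0 < #|J|)%N.
    have [mB [b b0 muBE]] := avB.
    have /set0P[z Bz] : B != set0.
      by apply/eqP => BE; move: muBE; rewrite BE measure0 => -[b0']; rewrite -b0' ltxx in b0.
    by have [j _] := BB _ Bz; apply/card_gt0P; exists j.
  have cJ : (0 < c * #|J|%:R)%R by rewrite mulr_gt0// ltr0n.
  have avgj j : avg (B_ j) (dual_weight q w) <= poweR X^-1 (q - 1)^-1.
    have := XB j; rewrite /dual_mean inve_pge ?inE ?poweR_ge0 ?(ltW X0)// => H.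
    have -> : avg (B_ j) (dual_weight q w) =
        poweR (poweR (avg (B_ j) (dual_weight q w)) (q - 1)) (q - 1)^-1.
      by rewrite -poweRrM mulfV ?gt_eqF// poweRe1.
    by apply: le_poweR => //; [rewrite invr_ge0 ltW|exact: poweR_ge0].
  have := avg_cover avB avB_ (@dual_weight_ge0 q w) (ltW c0) muB BB avgj.
  move=> /(le_poweR (ltW q0) (s0 _)).
  rewrite poweRM ?poweR_ge0 ?lee_fin ?(ltW cJ)// -poweRrM mulVf ?gt_eqF// poweRe1// poweR_EFin.
  set k := (_ `^ _)%R; have k0 : (0 < k)%R by rewrite powR_gt0.
  rewrite -lee_pdivrMl//.
  have kB0 : 0 <= (k^-1)%:E * poweR (avg B (dual_weight q w)) (q - 1).
    by rewrite mule_ge0 ?lee_fin ?invr_ge0 ?poweR_ge0// ltW.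
  rewrite inve_pge ?inE ?(ltW X0)// => /le_trans; apply.
  rewrite inveM; first by rewrite inver gt_eqF ?invr_gt0// invrK.
  have kV0 : (0 < k^-1)%R by rewrite invr_gt0.
  by case: (poweR _ _) => [y| |]; rewrite /inveM_def// (gt_eqF kV0) (ltW kV0) implybT.
Qed.

(** The conventions agree when the average of the dual weight is infinite: both sides
    then say that the average of [w] is zero. *)
Lemma Aq_product_leP q (A B : set st) w (C : R) : (0 < C)%R -> (forall z, 0 <= w z)%R ->
  (Aq_product q A B w <= C%:E) = (avg A (EFin \o w) <= C%:E * dual_mean q w B).
Proof.
move=> C0 w0; rewrite /Aq_product /dual_mean.
have : 0 <= poweR (avg B (dual_weight q w)) (q - 1) by exact: poweR_ge0.
have : 0 <= avg A (EFin \o w) by apply: avg_ge0 => z; rewrite lee_fin.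
move: (avg A _) (poweR _ _) => x [y| |]// x0; rewrite ?lee_fin => y0.
  rewrite inver; case: eqP => [->|/eqP yn0].
    by rewrite mule0 lee_fin (ltW C0) gt0_muley ?lte_fin// leey.
  by rewrite lee_pdivlMr// lt0r yn0.
rewrite invey mule0; apply/idP/idP => [|x00].
  apply: contraTT; rewrite -!ltNge => x1.
  by rewrite gt0_muley// ltry.
have -> : x = 0 by apply/eqP; rewrite eq_le x00.
by rewrite mul0e lee_fin ltW.
Qed.

End lower_means.

(** * Independence of the lag *)

Theorem theorem3p1 (R : realType) (n : nat) (p q gamma alpha tau : R)
    (hn : (1 <= n)%N) (hp : 1 < p) (hq : 1 < q)
    (hgamma : 0 < gamma) (hgamma_alpha : gamma <= alpha) (halpha : alpha < 1)
    (htau : 1 <= tau) :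
  [/\ forall w : spacetime R n -> R, weight w ->
        (in_Aq p q gamma w <->
         exists C : R, forall (x : Rn R n) (t L : R), 0 < L ->
           (Aq_product q (translated_lower p alpha tau x t L)
                         (upper p alpha x t L) w <= C%:E)%E),
      exists C : R -> R, forall w : spacetime R n -> R, weight w ->
        in_Aq p q gamma w ->
        forall (x : Rn R n) (t L : R), 0 < L ->
          (Aq_product q (translated_lower p alpha tau x t L)
                        (upper p alpha x t L) w
           <= (C (fine (Aq_const p q gamma w)))%:E)%E
    & forall w : spacetime R n -> R, weight w ->
        (in_A1 p gamma w <->
         exists C : R, forall (x : Rn R n) (t L : R), 0 < L ->
           (avg (translated_lower p alpha tau x t L) (EFin \o w)
            <= C%:E * ess_inf_on (upper p alpha x t L) w)%E)].
Proof.
have alpha0 : 0 <= alpha by lra.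
have gamma1 : gamma < 1 by lra.
have rho0 := @dilation_ratio_gt0 R n p gamma alpha tau alpha0 halpha gamma1 htau.
set rho := @dilation_ratio R n p gamma alpha tau in rho0.
pose K (c : R) (N : nat) : R := (c * N%:R) `^ (q - 1).
have K_gt0 c N : 0 < c -> (0 < N)%N -> 0 < K c N.
  by move=> c0 N0; rewrite powR_gt0// mulr_gt0// ltr0n.
have rhoK0 : 0 < rho * K rho 1 by rewrite mulr_gt0// K_gt0.
(* Nonnegativity excludes the value -oo, so a finite A_q constant is a real number
   and fine returns it. *)
have Aq_const_ge0 (w : spacetime R n -> R) : weight w -> (0 <= Aq_const p q gamma w)%E.
  move=> [w0 _].
  apply: (@le_trans _ _ (Aq_product q (lower p gamma [tuple 0 | i < n] 0 1)
      (upper p gamma [tuple 0 | i < n] 0 1) w)).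
    by rewrite mule_ge0 ?poweR_ge0// avg_ge0// => z; rewrite lee_fin.
  by apply: ereal_sup_ubound; exists [tuple 0 | i < n], 0, 1.
(* Adding 1 to the A_q constant makes it positive, as Aq_product_leP requires. *)
have Aq_translated (w : spacetime R n -> R) : weight w -> in_Aq p q gamma w ->
    forall (x : Rn R n) (t L : R), 0 < L ->
    (Aq_product q (translated_lower p alpha tau x t L) (upper p alpha x t L) w
     <= (rho * K rho 1 * (fine (Aq_const p q gamma w) + 1))%:E)%E.
  move=> ww wAq x t L L0; have [w0 _] := ww.
  have c0 : 0 <= fine (Aq_const p q gamma w) by rewrite fine_ge0// Aq_const_ge0.
  have c1 : 0 < fine (Aq_const p q gamma w) + 1 by lra.
  rewrite Aq_product_leP//; last by rewrite mulr_gt0.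
  apply: (one_sided_translated w0 (lower_mean_dual hq ww) hp) => //; first exact: ltW.
  move=> x' t' L' L'0; rewrite -Aq_product_leP//.
  apply: (@le_trans _ _ (Aq_const p q gamma w)).
    by apply: ereal_sup_ubound; exists x', t', L'.
  rewrite -[leLHS]fineK ?lee_fin ?lerDl//.
  by rewrite ge0_fin_numE// Aq_const_ge0.
split.
- move=> w ww; have [w0 _] := ww; split.
    by move=> wAq; eexists; exact: Aq_translated.
  move=> [C HC].
  have C1 : 0 < Num.max 1 C by rewrite lt_max ltr01.
  have [|C' C'0 H] := one_sided_lag K_gt0 w0 (lower_mean_dual hq ww) hp hgamma
      gamma1 alpha0 halpha htau (ltW C1).
    move=> x t L L0; rewrite -Aq_product_leP//.
    by rewrite (le_trans (HC x t L L0))// lee_fin le_max lexx orbT.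
  rewrite /in_Aq; apply: (@le_lt_trans _ _ C'%:E); last exact: ltry.
  apply: ge_ereal_sup => _ [x [t [L [L0 ->]]]].
  by rewrite Aq_product_leP//; exact: H.
- exists (fun c => rho * K rho 1 * (c + 1)) => w ww wAq; exact: Aq_translated.
- move=> w [w0 _]; have mP := lower_mean_ess_inf w0.
  have one_gt0 (c : R) (N : nat) : 0 < c -> (0 < N)%N -> 0 < 1 :> R by [].
  split.
    move=> [C C0 HC]; exists (rho * 1 * C) => x t L L0.
    by apply: (one_sided_translated w0 mP hp) => //; exact: ltW.
  move=> [C HC].
  have C1 : 0 < Num.max 1 C by rewrite lt_max ltr01.
  have [|C' C'0 H] := one_sided_lag one_gt0 w0 mP hp hgamma gamma1 alpha0 halpha htau (ltW C1).
    move=> x t L L0; apply: (le_trans (HC x t L L0)).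
    have [m0 _ _] := mP; apply: lee_wpmul2r; first exact: m0.
    by rewrite lee_fin le_max lexx orbT.
  by exists C'.
Qed.
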